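(* Let $k>0$, $0<\alpha\le\pi/2$, $\delta>0$ with $k\delta<\pi/2$, and let $r>\delta$. For $N\ge1$ let $n_0:=\lfloor N/2\rfloor$ and let $$\tilde I_w^{-1}(x):=\sum_{|n|<N/2}\frac{J_n(k|x|)^2}{s_n^2},\qquad s_n=2\pi\tilde\gamma\int_0^\delta J_n(k\rho)^2\,\rho\,d\rho,\qquad x\in\mathbb{R}^2,$$ be the (reciprocal) index function for the medium $D=B(0,\delta)\subset\mathbb{R}^2$. Then there exists a constant $C>0$ independent of $N$ such that, for all sufficiently large $N$, $$\frac{\overline{\|\tilde I_w^{-1}\|}_{L^1(B(0,r))}}{\overline{\|\tilde I_w^{-1}\|}_{L^1(B(0,\delta))}}\ge C\,\frac{(r/\delta)^{2n_0}}{N},$$ and the right-hand side tends to $\infty$ as $N\to\infty$. In particular, for large $N$ the ratio grows at least exponentially in $N$.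
   Context: $J_n$ is the Bessel function of the first kind of order $n$; sums are over integers $n$; $\tilde\gamma\neq0$ is a fixed constant (it cancels in the ratio). $B(0,\rho)$ is the disk of radius $\rho$ centred at $0$ in $\mathbb{R}^2$. For a bounded set $\Omega\subset\mathbb{R}^2$ of positive measure, the spatial average is $$\overline{\|f\|}_{L^1(\Omega)}:=\frac1{|\Omega|}\int_\Omega|f(x)|\,dx .$$ Origin of the setting: $N_y=2N+1$ measurement points $y_j=(\cos\theta_j,\sin\theta_j)$, $\theta_j=(j-N-1)\alpha/N$, are uniformly distributed on the arc of angles $[-\alpha,\alpha]$; $s_n$ are the Fourier coefficients of the Born far-field matrix $F(y_i,y_j)=\tilde\gamma\int_{B(0,\delta)}e^{ikz\cdot(y_i-y_j)}\,dz=\sum_{n\in\mathbb{Z}}s_ne^{in(\theta_i-\theta_j)}$; the quantity $\tilde I_w^{-1}$ is by definition the displayed sum over $|n|<N/2$. *)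

(* Defs.v *)
From HB Require Import structures.
From mathcomp Require Import all_boot all_order all_algebra.
From mathcomp Require Import all_classical all_reals all_analysis.
From mathcomp Require Import complex.

Set Implicit Arguments.
Unset Strict Implicit.
Unset Printing Implicit Defensive.

Import Order.TTheory GRing.Theory Num.Theory.
Import numFieldNormedType.Exports.

Local Open Scope classical_set_scope.
Local Open Scope ring_scope.
Local Open Scope complex_scope.

Section Bessel.
Variable R : realType.

Definition besselJ_coeff (n : nat) (x : R) : R^nat :=
  fun m => (-1) ^+ m / (m`! * (m + n)`!)%:R * (x / 2) ^+ (2 * m + n).

Definition besselJ_nat (n : nat) (x : R) : R :=
  limn (series (besselJ_coeff n x)).

(* For negative order, J_{-n} = (-1)^n J_n: in the power series of J_{-n} the
   terms with m < n vanish, because 1/Gamma does at nonpositive integers. *)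
Definition besselJ (n : int) (x : R) : R :=
  match n with
  | Posz p => besselJ_nat p x
  | Negz p => (-1) ^+ p.+1 * besselJ_nat p.+1 x
  end.

End Bessel.

Section Plane.
Variable R : realType.

Definition plane : Type := (measurableTypeR R * measurableTypeR R)%type.

Local Notation area := (@lebesgue_measure R \x @lebesgue_measure R)%E.

(* The library norm on a product is the maximum norm. *)
Definition enorm (x : plane) : R :=
  Num.sqrt ((x.1 : R) ^+ 2 + (x.2 : R) ^+ 2).

Definition disk (rho : R) : set plane := [set x | enorm x < rho].

Definition avgL1 (Omega : set plane) (f : plane -> R[i]) : R :=
  (fine (area Omega))^-1 *
  \int[area]_(x in Omega) ComplexField.Normc.normc (f x).

End Plane.

Section IndexFunction.
Variable R : realType.
Variables (k delta : R) (gamma : R[i]).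

(* The constant gamma may be complex, as a far-field constant may be; a real one
   is the special case gamma = g%:C. *)
Definition sFourier (n : int) : R[i] :=
  (2 * pi)%:C * gamma *
  (\int[@lebesgue_measure R]_(rho in `[0, delta])
     (besselJ n (k * rho) ^+ 2 * rho))%:C.

Definition Iw_inv (N : nat) (x : plane R) : R[i] :=
  \sum_(n \in [set n : int | (`|n|%:~R : R) < N%:R / 2])
    (besselJ n (k * enorm x) ^+ 2)%:C / sFourier n ^+ 2.

Definition avg_ratio (r : R) (N : nat) : R :=
  avgL1 (disk r) (Iw_inv N) / avgL1 (disk delta) (Iw_inv N).

End IndexFunction.

(* Main.v *)
(** Write [A_n = \int_0^delta J_n(k rho)^2 rho d rho] and let [L_n] be the leading
    term [(k delta / 2)^n / n!] of [J_n(k delta)].  Since [k delta < pi / 2 < 2],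
    the power series of [J_n] is alternating with decreasing terms on
    [[0, k delta]], so [J_n] is squeezed between two multiples of its leading
    term, and [A_n] lies between multiples of [delta^2 L_n^2 / (n + 1)] and
    [delta^2 L_n^2].  The factorials then make the weights [w_n = (L_n / A_n)^2]
    grow so fast that their sum up to the top mode [m] is bounded by a multiple
    of [w_m]; this controls the average over [B(0, delta)].  For the average
    over [B(0, r)] it suffices to keep the mode [m], for which the leading term
    is again a good approximation once [m] is large, and to integrate over the
    annulus of relative width [1 / (4 m)] at the boundary: there [|x|^(2m)] is at
    least [r^(2m) / 2], and the area of the annulus costs the factor [1 / N]. *)
Require Import Defs.
From HB Require Import structures.
From mathcomp Require Import all_boot all_order all_algebra.
From mathcomp Require Import all_classical all_reals all_analysis.
From mathcomp Require Import complex measurable_realfun ring lra zify.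
Set Implicit Arguments.
Unset Strict Implicit.
Unset Printing Implicit Defensive.

Import Order.TTheory GRing.Theory Num.Theory.
Import numFieldNormedType.Exports.

Local Open Scope classical_set_scope.
Local Open Scope ring_scope.

(** * Alternating sums and Bernoulli's inequality *)

Lemma alternating_sum_bounds (R : realFieldType) (a : nat -> R) n :
  (forall i, 0 <= a i) -> (forall i, a i.+1 <= a i) ->
  0 <= \sum_(0 <= i < n) (-1) ^+ i * a i <= a 0%N.
Proof.
elim: n a => [|n IHn] a a_ge0 a_dec; first by rewrite big_geq// lexx a_ge0.
rewrite big_nat_recl// expr0 mul1r.
under eq_bigr do rewrite exprS mulN1r mulNr.
rewrite sumrN.
(* What follows the first term is minus the alternating sum of the shifted sequence, which lies
   between [0] and [a 1]. *)
have /andP[] := IHn (fun i => a i.+1) (fun i => a_ge0 i.+1) (fun i => a_dec i.+1).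
have := a_dec 0%N; lra.
Qed.

Lemma alternating_sum_lower (R : realFieldType) (a : nat -> R) n :
  (forall i, 0 <= a i) -> (forall i, a i.+1 <= a i) ->
  a 0%N - a 1%N <= \sum_(0 <= i < n.+1) (-1) ^+ i * a i.
Proof.
move=> a_ge0 a_dec; rewrite big_nat_recl// expr0 mul1r.
under eq_bigr do rewrite exprS mulN1r mulNr.
rewrite sumrN.
have /andP[_] := @alternating_sum_bounds _ (fun i => a i.+1) n
  (fun i => a_ge0 i.+1) (fun i => a_dec i.+1).
lra.
Qed.

Lemma bernoulli (R : realFieldType) (x : R) n : -1 <= x ->
  1 + x *+ n <= (1 + x) ^+ n.
Proof.
move=> x_ge; elim: n => [|n IHn]; first by rewrite mulr0n addr0.
rewrite exprS; apply: (@le_trans _ _ ((1 + x) * (1 + x *+ n))); last first.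
  by apply: ler_wpM2l => //; lra.
rewrite mulrSr -mulr_natr.
have n0 : 0 <= n%:R :> R by [].
have := mulr_ge0 n0 (sqr_ge0 x); lra.
Qed.

(** * Bessel functions of natural order against their leading term *)

Section Bessel.
Variable R : realType.
Implicit Types (x y : R) (n m : nat).

Definition besselJ_lead n x : R := (x / 2) ^+ n / n`!%:R.

Definition besselJ_abs n x m : R :=
  (x / 2) ^+ (2 * m + n) / (m`! * (m + n)`!)%:R.

Lemma besselJ_coeffE n x m :
  besselJ_coeff n x m = (-1) ^+ m * besselJ_abs n x m.
Proof. by rewrite /besselJ_coeff /besselJ_abs mulrAC mulrA. Qed.

Lemma besselJ_lead_ge0 n x : 0 <= x -> 0 <= besselJ_lead n x.
Proof. by move=> x0; rewrite divr_ge0// exprn_ge0// divr_ge0. Qed.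

Lemma besselJ_lead_gt0 n x : 0 < x -> 0 < besselJ_lead n x.
Proof. by move=> x0; rewrite divr_gt0 ?exprn_gt0 ?divr_gt0// ltr0n fact_gt0. Qed.

Lemma besselJ_lead_le n x y : 0 <= x -> x <= y ->
  besselJ_lead n x <= besselJ_lead n y.
Proof.
move=> x0 xy; rewrite ler_wpM2r// ?invr_ge0//.
by rewrite lerXn2r ?nnegrE//; lra.
Qed.

Lemma besselJ_leadM n c x : besselJ_lead n (c * x) = c ^+ n * besselJ_lead n x.
Proof. by rewrite /besselJ_lead -mulrA exprMn mulrA. Qed.

Lemma besselJ_leadS n x :
  besselJ_lead n.+1 x = (x / 2) / n.+1%:R * besselJ_lead n x.
Proof.
rewrite /besselJ_lead exprS factS natrM invfM; ring.
Qed.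

Lemma besselJ_abs_ge0 n x m : 0 <= x -> 0 <= besselJ_abs n x m.
Proof. by move=> x0; rewrite divr_ge0// exprn_ge0// divr_ge0. Qed.

Lemma besselJ_abs0 n x : besselJ_abs n x 0 = besselJ_lead n x.
Proof. by rewrite /besselJ_abs /besselJ_lead muln0 add0n fact0 mul1n. Qed.

Lemma besselJ_absS n x m : besselJ_abs n x m.+1 =
  (x / 2) ^+ 2 / (m.+1 * (m.+1 + n))%:R * besselJ_abs n x m.
Proof.
rewrite /besselJ_abs addSn !factS.
have -> : (2 * m.+1 + n = 2 + (2 * m + n))%N by lia.
have -> : (m.+1 * m`! * ((m + n).+1 * (m + n)`!) =
   (m.+1 * (m + n).+1) * (m`! * (m + n)`!))%N by lia.
by rewrite exprD natrM invfM mulrACA.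
Qed.

(** The ratio of consecutive terms is largest at [m = 0], where the hypothesis bounds it by [1]. *)
Lemma besselJ_abs_dec n x m : 0 <= x -> (x / 2) ^+ 2 <= n.+1%:R ->
  besselJ_abs n x m.+1 <= besselJ_abs n x m.
Proof.
move=> x0 xn; rewrite besselJ_absS ler_piMl ?besselJ_abs_ge0//.
rewrite ler_pdivrMr ?ltr0n ?muln_gt0// mul1r (le_trans xn)// ler_nat; nia.
Qed.

(** Dropping [(m + n)!] from the denominator leaves the terms of an exponential series, which yields
    convergence for every [x >= 0]. *)
Lemma besselJ_abs_le_exp n x m : 0 <= x ->
  besselJ_abs n x m <= (x / 2) ^+ n * exp_coeff ((x / 2) ^+ 2) m.
Proof.
move=> x0; rewrite exp_coeffE /= /besselJ_abs exprD exprM.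
rewrite [_ * (x / 2) ^+ n]mulrC -!mulrA ler_wpM2l ?exprn_ge0 ?divr_ge0//.
rewrite [leRHS]mulrC ler_wpM2l ?exprn_ge0 ?divr_ge0//.
rewrite lef_pV2 ?posrE ?ltr0n ?muln_gt0 ?fact_gt0//.
by rewrite ler_nat leq_pmulr// fact_gt0.
Qed.

Lemma is_cvg_besselJ n x : 0 <= x -> cvgn (series (besselJ_coeff n x)).
Proof.
move=> x0; apply: normed_cvg.
apply: (@series_le_cvg _ _ ((x / 2) ^+ n *: exp_coeff ((x / 2) ^+ 2))).
- by move=> m; rewrite normr_ge0.
- by move=> m; rewrite mulr_ge0 ?exp_coeff_ge0 ?sqr_ge0 ?exprn_ge0 ?divr_ge0.
- move=> m; rewrite /= besselJ_coeffE normrM normrX normrN1 expr1n mul1r.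
  by rewrite ger0_norm ?besselJ_abs_ge0// besselJ_abs_le_exp.
- exact/is_cvg_seriesZ/is_cvg_series_exp_coeff.
Qed.

Lemma besselJ_le_lead n x : 0 <= x -> (x / 2) ^+ 2 <= n.+1%:R ->
  0 <= besselJ_nat n x <= besselJ_lead n x.
Proof.
move=> x0 xn; have cJ := @is_cvg_besselJ n x x0.
have b N : 0 <= series (besselJ_coeff n x) N <= besselJ_lead n x.
  rewrite /series/=; under eq_bigr do rewrite besselJ_coeffE.
  rewrite -besselJ_abs0; apply: alternating_sum_bounds => i.
    exact: besselJ_abs_ge0.
  exact: besselJ_abs_dec.
apply/andP; split; [apply: limr_ge|apply: limr_le] => //;
  by near=> N; have /andP[] := b N.
Unshelve. all: by end_near. Qed.

Lemma besselJ_ge_lead n x : 0 <= x -> (x / 2) ^+ 2 <= n.+1%:R ->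
  (1 - (x / 2) ^+ 2 / n.+1%:R) * besselJ_lead n x <= besselJ_nat n x.
Proof.
move=> x0 xn; apply: limr_ge; first exact: is_cvg_besselJ.
near=> N; have [M ->] : exists M, N = M.+1.
  by exists N.-1; rewrite prednK//; near: N; exact: nbhs_infty_gt.
rewrite /series/=; under eq_bigr do rewrite besselJ_coeffE.
apply: (@le_trans _ _ (besselJ_abs n x 0 - besselJ_abs n x 1)).
  by rewrite besselJ_absS besselJ_abs0 mul1n mulrBl mul1r.
apply: alternating_sum_lower => i.
  exact: besselJ_abs_ge0.
exact: besselJ_abs_dec.
Unshelve. all: by end_near. Qed.

(** Unlike the comparison with the leading term, this crude bound holds for arguments of any size.
    It makes the low modes integrable over a large disk. *)
Lemma besselJ_bounded n x : 0 <= x ->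
  `|besselJ_nat n x| <= (x / 2) ^+ n * expR ((x / 2) ^+ 2).
Proof.
move=> x0; have cJ := @is_cvg_besselJ n x x0.
have b N : `|series (besselJ_coeff n x) N| <= (x / 2) ^+ n * expR ((x / 2) ^+ 2).
  apply: (le_trans (ler_norm_sum _ _ _)).
  apply: (@le_trans _ _
    (\sum_(0 <= i < N) (x / 2) ^+ n * exp_coeff ((x / 2) ^+ 2) i)).
    apply: ler_sum => m _.
    rewrite besselJ_coeffE normrM normrX normrN1 expr1n mul1r.
    by rewrite ger0_norm ?besselJ_abs_ge0// besselJ_abs_le_exp.
  rewrite -mulr_sumr ler_wpM2l ?exprn_ge0 ?divr_ge0//.
  apply: (@nondecreasing_cvgn_le _ (series (exp_coeff ((x / 2) ^+ 2)))); last first.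
    exact: is_cvg_series_exp_coeff.
  by apply: nondecreasing_series => i _ _; rewrite exp_coeff_ge0// sqr_ge0.
rewrite ler_norml; apply/andP; split; [apply: limr_ge|apply: limr_le] => //;
  by near=> N; have := b N; rewrite ler_norml => /andP[].
Unshelve. all: by end_near. Qed.

Lemma measurable_besselJ d (T : measurableType d) n (D : set T) (f : T -> R) :
  measurable D -> measurable_fun D f -> (forall t, D t -> 0 <= f t) ->
  measurable_fun D (fun t => besselJ_nat n (f t)).
Proof.
move=> mD mf f0.
apply: (@measurable_fun_cvg _ _ _ _ (fun N t => series (besselJ_coeff n (f t)) N)).
  move=> N; rewrite /series/=.
  apply: measurable_sum => m.
  apply: measurable_funM => //; apply: measurable_funX.
  exact: measurable_funM.
by move=> t Dt; apply: is_cvg_besselJ; exact: f0.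
Qed.

End Bessel.

(** * Two-sided bounds for real-valued integrals *)

Section IntegralBounds.
Context d (T : measurableType d) (R : realType) (mu : {measure set T -> \bar R}).
Variables (D E : set T) (f : T -> R) (c M : R).
Hypotheses (mD : measurable D) (mE : measurable E) (ED : E `<=` D).
Hypotheses (muD : (mu D < +oo)%E) (mf : measurable_fun D f).
Hypotheses (f_ge0 : forall x, D x -> 0 <= f x) (f_le : forall x, D x -> f x <= M).
Hypotheses (c_ge0 : 0 <= c) (f_ge : forall x, E x -> c <= f x).

Lemma bounded_integrable : mu.-integrable D (EFin \o f).
Proof.
apply: measurable_bounded_integrable => //.
exists M; split; first exact: num_real.
by move=> y My x Dx; rewrite /= ger0_norm ?f_ge0// (le_trans (f_le Dx))// ltW.
Qed.

(** For the lower bound the domain shrinks to [E], as [f] is nonnegative. The bound [M] serves both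
    halves: it makes [f] integrable, whereas an infinite integral would have real value [0]. *)
Lemma Rintegral_bounds :
  c * fine (mu E) <= \int[mu]_(x in D) f x <= M * fine (mu D).
Proof.
have if_ := bounded_integrable; apply/andP; split; last first.
  rewrite -Rintegral_cst//; apply: le_Rintegral => //.
  apply/integrableP; split; first exact: measurable_cst.
  by rewrite /= (integral_cst mu mD `|M%:E|%E) lte_mul_pinfty.
have muE : mu E \is a fin_num.
  by rewrite ge0_fin_numE// (le_lt_trans _ muD)// le_measure ?inE.
rewrite /Rintegral -lee_fin EFinM fineK// fineK; last exact: integrable_fin_num.
rewrite -integral_cst//; apply: (@le_trans _ _ (\int[mu]_(x in E) (f x)%:E)%E).
  apply: ge0_le_integral => //.
  by apply/measurable_EFinP; exact: measurable_funS mf.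
apply: ge0_subset_integral => //; exact/measurable_EFinP.
Qed.

End IntegralBounds.

(** * Disks and annuli in the Euclidean plane *)

Section Plane.
Variable R : realType.

Local Notation area := (@lebesgue_measure R \x @lebesgue_measure R)%E.
Implicit Types (rho s : R).

Lemma enorm_ge0 (x : plane R) : 0 <= enorm x.
Proof. exact: sqrtr_ge0. Qed.

Lemma measurable_enorm : measurable_fun setT (@enorm R).
Proof.
have msqrt : measurable_fun setT (Num.sqrt : R -> R).
  by apply: continuous_measurable_fun; exact: sqrt_continuous.
have -> : @enorm R = Num.sqrt \o (fun x => (x.1 : R) ^+ 2 + (x.2 : R) ^+ 2) by [].
apply: (measurableT_comp msqrt).
apply: measurable_funD; apply: measurable_funX.
  exact: measurable_fst.
exact: measurable_snd.
Qed.

Lemma enorm_ltE (x : plane R) rho : 0 <= rho ->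
  (enorm x < rho) = (x.1 ^+ 2 + x.2 ^+ 2 < rho ^+ 2).
Proof.
move=> rho0; rewrite /enorm -(ltr_pXn2r (_ : 0 < 2)%N) ?nnegrE ?sqrtr_ge0//.
by rewrite sqr_sqrtr// addr_ge0 ?sqr_ge0.
Qed.

Lemma measurable_disk rho : measurable (disk rho).
Proof.
have -> : disk rho = setT `&` @enorm R @^-1` [set` `]-oo, rho[].
  by rewrite setTI; apply/seteqP; split => x /=; rewrite in_itv.
exact: measurable_enorm.
Qed.

Definition annulus s rho : set (plane R) := [set x | s <= enorm x < rho].

Lemma measurable_annulus s rho : measurable (annulus s rho).
Proof.
have -> : annulus s rho = setT `&` @enorm R @^-1` [set` `[s, rho[].
  by rewrite setTI; apply/seteqP; split => x /=; rewrite in_itv.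
exact: measurable_enorm.
Qed.

Lemma area_disk_lty rho : (area (disk rho) < +oo)%E.
Proof.
apply: (@le_lt_trans _ _ (area (`[- rho, rho] `*` `[- rho, rho]))).
  apply: le_measure; rewrite ?inE.
  - exact: measurable_disk.
  - exact: measurableX.
  move=> x; rewrite /disk/= => xrho.
  have rho0 : 0 <= rho by rewrite (le_trans (enorm_ge0 x))// ltW.
  have : x.1 ^+ 2 + x.2 ^+ 2 < rho ^+ 2 by rewrite -enorm_ltE.
  rewrite !in_itv/= -!ler_norml => h.
  split; rewrite -(ler_pXn2r (_ : 0 < 2)%N) ?nnegrE// real_normK ?num_real//.
    by have := sqr_ge0 (x.2 : R); lra.
  by have := sqr_ge0 (x.1 : R); lra.
rewrite product_measure1E//= lebesgue_measure_itv/= -EFinB.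
by case: ifP => _; rewrite ?mule0// -EFinM ltry.
Qed.

(* The sections of the annulus over abscissas in [0, rho / 2] contain an
   interval of length at least [(rho ^ 2 - s ^ 2) / (2 rho)]. *)
Lemma area_annulus_ge s rho : rho / 2 <= s -> s <= rho -> 0 < rho ->
  rho * (rho - s) / 4 <= fine (area (annulus s rho)).
Proof.
move=> rho2s s_le rho0.
have fin : area (annulus s rho) \is a fin_num.
  rewrite ge0_fin_numE//; apply: le_lt_trans (area_disk_lty rho).
  apply: le_measure; rewrite ?inE.
  - exact: measurable_annulus.
  - exact: measurable_disk.
  by move=> x /andP[].
rewrite -lee_fin fineK//.
have m1 : measurable_fun setT
    ((@lebesgue_measure R) \o xsection (annulus s rho)).
  by apply: measurable_fun_xsection; exact: measurable_annulus.
(* The product measure integrates the lengths of the vertical sections; only the abscissas in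
   [[0, rho / 2]] are kept. *)
apply: (@le_trans _ _
  (\int[@lebesgue_measure R]_(x in `[0%R, (rho / 2)%R])
     ((@lebesgue_measure R) \o xsection (annulus s rho)) x)%E); last first.
  by apply: ge0_subset_integral.
apply: (@le_trans _ _
  (\int[@lebesgue_measure R]_(x in `[0%R, (rho / 2)%R]) ((rho - s) / 2)%:E)%E).
  rewrite integral_cst//= lebesgue_measure_itv/= lte_fin divr_gt0//.
  by rewrite -EFinB -EFinM lee_fin; lra.
apply: ge0_le_integral => //.
- by move=> x _; rewrite lee_fin; lra.
- exact: measurable_funTS.
move=> x /=; rewrite in_itv/= => /andP[x0 xrho].
have s0 : 0 < s by lra.
have xs : 0 <= s ^+ 2 - x ^+ 2 by rewrite subr_ge0 lerXn2r ?nnegrE//; lra.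
have xr : 0 <= rho ^+ 2 - x ^+ 2 by rewrite subr_ge0 lerXn2r ?nnegrE//; lra.
set u := Num.sqrt (s ^+ 2 - x ^+ 2); set v := Num.sqrt (rho ^+ 2 - x ^+ 2).
have u2 : u ^+ 2 = s ^+ 2 - x ^+ 2 by rewrite sqr_sqrtr.
have v2 : v ^+ 2 = rho ^+ 2 - x ^+ 2 by rewrite sqr_sqrtr.
have u0 : 0 <= u by exact: sqrtr_ge0.
have v0 : 0 <= v by exact: sqrtr_ge0.
have ler2 (a b : R) : 0 <= a -> 0 <= b -> a ^+ 2 <= b ^+ 2 -> a <= b.
  by move=> a0 b0; rewrite ler_pXn2r.
have x2 := sqr_ge0 x.
have us : u <= s by apply: ler2 => //; lra.
have vr : v <= rho by apply: ler2 => //; lra.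
have uv : u <= v.
  apply: ler2 => //.
  have : s ^+ 2 <= rho ^+ 2 by rewrite lerXn2r ?nnegrE//; lra.
  lra.
(* Here [(v - u) * (v + u) = (rho - s) * (rho + s)], with [v + u <= 2 * rho] and
   [rho + s >= rho]. *)
have gap : (rho - s) / 2 <= v - u.
  have : (rho - s) * rho <= (v - u) * (2 * rho).
    have -> : (rho - s) * rho = rho ^+ 2 - s * rho by ring.
    nra.
  nra.
apply: (@le_trans _ _ (lebesgue_measure (`[u, v[ : set R))).
  rewrite lebesgue_measure_itv/= lte_fin; case: ifPn => [_|].
    by rewrite -EFinB lee_fin.
  by rewrite -leNgt lee_fin; lra.
apply: le_measure; rewrite ?inE//.
  by apply: measurable_xsection; exact: measurable_annulus.
move=> y /=; rewrite in_itv/= => /andP[uy yv].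
rewrite /xsection/= inE /annulus/=.
have hu : u ^+ 2 <= y ^+ 2 by rewrite lerXn2r ?nnegrE//; lra.
have hv : y ^+ 2 < v ^+ 2 by rewrite ltrXn2r ?nnegrE//; lra.
rewrite leNgt !enorm_ltE ?ltW//=.
by rewrite -leNgt; apply/andP; split; lra.
Qed.

End Plane.

(** * Powers close to one and geometric sums *)

Lemma half_le_expr (R : realFieldType) p : (0 < p)%N ->
  2^-1 <= (1 - (2 * p)%:R^-1) ^+ p :> R.
Proof.
move=> p0; have p0' : (0 : R) < p%:R by rewrite ltr0n.
have p1 : (1 : R) <= p%:R by rewrite ler1n.
have pV : (2 * p)%:R^-1 <= 1 :> R.
  by rewrite invf_le1 ?ltr0n ?muln_gt0// ler1n muln_gt0.
(* Bernoulli's inequality gives exactly [1 - p / (2 * p)], that is, one half. *)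
apply: le_trans (@bernoulli R (- (2 * p)%:R^-1) p _); last by rewrite lerN2.
rewrite -[_ *+ p]mulr_natr natrM.
by have -> : 1 + - (2 * p%:R)^-1 * p%:R = 2^-1 :> R by field; lra.
Qed.

(** The bound is the fixed point of [s = q * s + 1], the recursion that these sums satisfy. *)
Lemma geometric_sum_le (R : realFieldType) (q : R) m : 0 <= q -> q < 1 ->
  \sum_(i < m.+1) q ^+ (m - i) <= (1 - q)^-1.
Proof.
move=> q0 q1; have q1' : 0 < 1 - q by lra.
elim: m => [|m IHm].
  by rewrite big_ord1 subnn expr0 invf_ge1//; lra.
rewrite big_ord_recr /= subnn expr0.
under eq_bigr => i _ do rewrite subSn ?leq_ord// exprS.
rewrite -mulr_sumr.
have -> : (1 - q)^-1 = q * (1 - q)^-1 + 1 by field; lra.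
by rewrite lerD2r ler_wpM2l.
Qed.

(** * Radial masses and the growth of the weights *)

Section RadialMass.
Variables (R : realType) (k delta : R).
Hypotheses (k_gt0 : 0 < k) (delta_gt0 : 0 < delta).
Implicit Types n m : nat.

Local Notation q := ((k * delta / 2) ^+ 2).
Hypothesis q_lt1 : q < 1.

(** Up to the factor [2 * pi * gamma], this is the Fourier coefficient of order [n] and also of
    order [-n]. *)
Definition radial_mass n : R :=
  \int[@lebesgue_measure R]_(rho in `[0, delta])
    (besselJ_nat n (k * rho) ^+ 2 * rho).

Local Notation L := (fun n => besselJ_lead n (k * delta)).

Let kd_gt0 : 0 < k * delta. Proof. exact: mulr_gt0. Qed.

(** On the disk [(k * rho / 2) ^+ 2 <= q < 1 <= n.+1], so the comparison with the leading term holds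
    for all orders with the same constant [1 - q]. *)
Lemma besselJ_disk rho n : 0 <= rho -> rho <= delta ->
  (1 - q) * besselJ_lead n (k * rho) <= besselJ_nat n (k * rho)
    <= besselJ_lead n (k * rho) /\ 0 <= besselJ_nat n (k * rho).
Proof.
move=> rho0 rho_le.
have x0 : 0 <= k * rho by rewrite mulr_ge0// ltW.
have xq : (k * rho / 2) ^+ 2 <= q.
  have : k * rho <= k * delta by rewrite ler_pM2l.
  by move=> h; have := kd_gt0; rewrite lerXn2r ?nnegrE//; lra.
have n1 : 1 <= n.+1%:R :> R by rewrite ler1n.
have xn : (k * rho / 2) ^+ 2 <= n.+1%:R.
  by rewrite (le_trans xq)// ltW// (lt_le_trans q_lt1).
have /andP[-> ->] := besselJ_le_lead x0 xn; split=> //; rewrite andbT.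
apply: le_trans (besselJ_ge_lead x0 xn).
rewrite ler_wpM2r ?besselJ_lead_ge0// lerD2l lerN2.
by rewrite ler_pdivrMr ?ltr0n// (le_trans xq)// ler_peMr// sqr_ge0.
Qed.

Lemma radial_mass_bounds n :
  ((1 - q) * delta * L n) ^+ 2 / (8 * n.+1%:R)
    <= radial_mass n <= (delta * L n) ^+ 2.
Proof.
(* The integrand behaves like [rho ^+ p]. On [[t * delta, delta]] this power keeps half of its
   maximum, and the interval has length [delta / (2 * p)]; then [4 * p <= 8 * n.+1] gives the
   constant. *)
set p := (2 * n).+1; set t : R := 1 - (2 * p)%:R^-1.
have tp : 2^-1 <= t ^+ p by exact: half_le_expr.
have p0 : 0 < p%:R :> R by rewrite ltr0n.
have pV : (2 * p)%:R^-1 <= 1 :> R by rewrite invf_le1 ?ltr0n ?ler1n.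
have t0 : 0 <= t by rewrite subr_ge0.
have t1 : t < 1 by rewrite ltrBlDr ltrDl invr_gt0 ltr0n.
have L0 : 0 < L n by exact: besselJ_lead_gt0.
have mD : measurable (`[0, delta] : set R) by [].
have mE : measurable (`[t * delta, delta] : set R) by [].
have ED : `[t * delta, delta] `<=` (`[0, delta] : set R).
  move=> x; rewrite /= !in_itv/= => /andP[tx ->]; rewrite andbT.
  by apply: le_trans tx; rewrite mulr_ge0// ltW.
have muD : (@lebesgue_measure R `[0%R, delta] = delta%:E)%E.
  by rewrite lebesgue_measure_itv/= lte_fin delta_gt0 -EFinB subr0.
have muE : (@lebesgue_measure R `[(t * delta)%R, delta] = ((1 - t) * delta)%:E)%E.
  rewrite lebesgue_measure_itv/= lte_fin gtr_pMl// t1.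
  by rewrite -EFinB; congr EFin; ring.
have mf : measurable_fun (`[0, delta] : set R)
    (fun rho => besselJ_nat n (k * rho) ^+ 2 * rho).
  apply: measurable_funM => //; apply: measurable_funX.
  apply: measurable_besselJ => //.
  by move=> x; rewrite /= in_itv/= => /andP[x0 _]; rewrite mulr_ge0// ltW.
have q1' : 0 < 1 - q by rewrite subr_gt0.
have /andP[] : (((1 - q) * (t ^+ n * L n)) ^+ 2 * (t * delta)) *
      fine (@lebesgue_measure R `[t * delta, delta]) <= radial_mass n
    <= (L n ^+ 2 * delta) * fine (@lebesgue_measure R `[0, delta]).
  apply: (@Rintegral_bounds _ _ _ (@lebesgue_measure R) _ _ _ _ _
    mD mE ED _ mf).
  - by have := ltry delta; rewrite -muD.
  - move=> x; rewrite /= in_itv/= => /andP[x0 _].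
    by rewrite mulr_ge0// sqr_ge0.
  - move=> x; rewrite /= in_itv/= => /andP[x0 xd].
    have [/andP[_ J_le] J0] := besselJ_disk n x0 xd.
    apply: ler_pM => //; first exact: sqr_ge0.
    rewrite lerXn2r ?nnegrE// ?(ltW L0)// (le_trans J_le)// besselJ_lead_le//.
      by rewrite mulr_ge0// ltW.
    by rewrite ler_pM2l.
  - by rewrite mulr_ge0 ?sqr_ge0// mulr_ge0// ltW.
  - move=> x; rewrite /= in_itv/= => /andP[tx xd].
    have td0 : 0 <= t * delta by rewrite mulr_ge0// ltW.
    have x0 : 0 <= x by rewrite (le_trans td0).
    have [/andP[J_ge _] J0] := besselJ_disk n x0 xd.
    have tL0 : 0 <= (1 - q) * (t ^+ n * L n).
      by rewrite mulr_ge0 ?(ltW q1')// mulr_ge0 ?exprn_ge0 ?(ltW L0).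
    apply: ler_pM => //; first exact: sqr_ge0.
    rewrite lerXn2r ?nnegrE// (le_trans _ J_ge)// ler_wpM2l ?(ltW q1')//.
    rewrite -besselJ_leadM; apply: besselJ_lead_le.
      by rewrite mulr_ge0// ltW.
    by rewrite mulrCA ler_pM2l.
rewrite muD muE /= => lo up; apply/andP; split; last first.
  by have -> : (delta * L n) ^+ 2 = L n ^+ 2 * delta * delta by ring.
apply: le_trans lo.
have -> : ((1 - q) * (t ^+ n * L n)) ^+ 2 * (t * delta) * ((1 - t) * delta) =
    ((1 - q) * delta * L n) ^+ 2 * (t ^+ p * (1 - t)).
  have -> : t ^+ p = t * (t ^+ n) ^+ 2 by rewrite /p exprS mulnC exprM.
  ring.
rewrite ler_wpM2l ?sqr_ge0//.
have -> : 1 - t = (2 * p)%:R^-1 by rewrite /t; ring.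
rewrite ler_pdivlMr ?ltr0n// ler_pdivrMl; last first.
  by rewrite mulr_gt0// ltr0n.
have h : p%:R <= 2 * n.+1%:R :> R.
  by rewrite -natrM ler_nat /p mulnS addSn ltnS leq_addl.
rewrite natrM.
apply: (@le_trans _ _ (8 * n.+1%:R * 2^-1)); first lra.
by rewrite ler_wpM2l// mulr_ge0.
Qed.

Lemma radial_mass_gt0 n : 0 < radial_mass n.
Proof.
have /andP[+ _] := radial_mass_bounds n; apply: lt_le_trans.
by rewrite !(divr_gt0, exprn_gt0, mulr_gt0, besselJ_lead_gt0, subr_gt0).
Qed.

(** Raising the order by one multiplies the leading term by [k * delta / 2] over the new order. The
    first such denominator is the [n.+1] on the left; the later ones are only bounded below by
    [1]. *)
Lemma besselJ_lead_decay n j :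
  (n.+1%:R * L (n + j.+1)%N) ^+ 2 <= q ^+ j.+1 * L n ^+ 2.
Proof.
elim: j => [|j IHj].
  rewrite addn1 besselJ_leadS expr1 le_eqVlt; apply/predU1P; left.
  have : n.+1%:R != 0 :> R by rewrite pnatr_eq0.
  by move=> n0; field.
rewrite addnS besselJ_leadS [q ^+ j.+2]exprS.
set c := (n + j.+1).+1%:R.
have c1 : 1 <= c :> R by rewrite ler1n.
have -> : (n.+1%:R * (k * delta / 2 / c * L (n + j.+1)%N)) ^+ 2 =
   q * (c ^+ 2)^-1 * (n.+1%:R * L (n + j.+1)%N) ^+ 2 by field; lra.
rewrite -[leLHS]mulrA -[leRHS]mulrA ler_wpM2l ?sqr_ge0//; apply: le_trans IHj.
by rewrite ler_piMl ?sqr_ge0// invf_le1 ?exprn_ege1// exprn_gt0//; lra.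
Qed.

Definition weight n : R := (L n / radial_mass n) ^+ 2.

Lemma weight_gt0 n : 0 < weight n.
Proof. by rewrite exprn_gt0// divr_gt0 ?besselJ_lead_gt0 ?radial_mass_gt0. Qed.

(** The lower bound on the mass of order [n] loses a factor [n.+1], and the decay of the leading
    term from [n] to [m] makes up for it. What remains of the decay is [q ^+ (m - n)]. *)
Lemma weight_le n m : (n <= m)%N ->
  weight n <= 64 / (1 - q) ^+ 4 * q ^+ (m - n) * weight m.
Proof.
have q1' : 0 < 1 - q by rewrite subr_gt0.
have q0 : 0 <= q by exact: sqr_ge0.
(* The case [n = m] is apart because the decay estimate takes at least one step; there the constant
   alone is at least [1]. *)
rewrite leq_eqVlt => /predU1P[<-|nm].
  rewrite subnn expr0 mulr1 ler_peMl ?(ltW (weight_gt0 _))//.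
  rewrite ler_pdivlMr ?exprn_gt0// mul1r.
  by apply: (@le_trans _ _ 1); [rewrite exprn_ile1//; lra|lra].
have [j ->] : exists j, m = (n + j.+1)%N by exists (m - n.+1)%N; lia.
rewrite addKn.
have := besselJ_lead_decay n j; set m' := (n + j.+1)%N => decay.
have Ln0 : 0 < L n by exact: besselJ_lead_gt0.
have Lm0 : 0 < L m' by exact: besselJ_lead_gt0.
have An0 := radial_mass_gt0 n; have Am0 := radial_mass_gt0 m'.
have /andP[lo _] := radial_mass_bounds n.
have /andP[_ up] := radial_mass_bounds m'.
rewrite /weight.
move: (radial_mass n) (radial_mass m') An0 Am0 lo up => An Am An0 Am0 lo up.
have n0 : 0 < n.+1%:R :> R by rewrite ltr0n.
have wm : ((delta ^+ 2 * L m') ^+ 2)^-1 <= (L m' / Am) ^+ 2.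
  have d2L : 0 < delta ^+ 2 * L m' by rewrite mulr_gt0// exprn_gt0.
  rewrite -exprVn lerXn2r ?nnegrE ?invr_ge0 ?(ltW d2L) ?(ltW (divr_gt0 _ _))//.
  rewrite ler_pdivlMr// ler_pdivrMl//.
  by apply: le_trans up _; rewrite exprMn expr2 mulrA.
have wn : (L n / An) ^+ 2 <=
    (8 * n.+1%:R / ((1 - q) ^+ 2 * delta ^+ 2 * L n)) ^+ 2.
  have d2L : 0 < (1 - q) ^+ 2 * delta ^+ 2 * L n.
    by apply: mulr_gt0 => //; apply: mulr_gt0; apply: exprn_gt0.
  have LA : 0 <= L n / An by exact: divr_ge0 (ltW Ln0) (ltW An0).
  have L8 : 0 <= 8 * n.+1%:R / ((1 - q) ^+ 2 * delta ^+ 2 * L n).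
    by apply: divr_ge0 (ltW d2L); apply: mulr_ge0.
  rewrite lerXn2r// ler_pdivrMr// mulrAC ler_pdivlMr//.
  have -> : L n * ((1 - q) ^+ 2 * delta ^+ 2 * L n) =
      ((1 - q) * delta * L n) ^+ 2 by ring.
  by rewrite [leRHS]mulrC -ler_pdivrMr// mulr_gt0.
have K0 : 0 <= 64 / (1 - q) ^+ 4.
  by apply: divr_ge0 => //; apply/exprn_ge0/ltW.
apply: (le_trans wn).
apply: (@le_trans _ _ (64 / (1 - q) ^+ 4 * q ^+ j.+1 *
   ((delta ^+ 2 * L m') ^+ 2)^-1)); last first.
  by apply: ler_wpM2l wm; apply: mulr_ge0 K0 _; exact: exprn_ge0.
have -> : (8 * n.+1%:R / ((1 - q) ^+ 2 * delta ^+ 2 * L n)) ^+ 2 =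
   64 / (1 - q) ^+ 4 / ((delta ^+ 2) ^+ 2 * (L n * L m') ^+ 2)
     * (n.+1%:R * L m') ^+ 2.
  move: (1 - q) q1' => c c0; have := gt_eqF c0; have := gt_eqF delta_gt0.
  have := gt_eqF Ln0; have := gt_eqF Lm0 => *; field.
  by do ?[apply/andP; split]; apply/negbT.
have -> : 64 / (1 - q) ^+ 4 * q ^+ j.+1 * ((delta ^+ 2 * L m') ^+ 2)^-1 =
   64 / (1 - q) ^+ 4 / ((delta ^+ 2) ^+ 2 * (L n * L m') ^+ 2)
     * (q ^+ j.+1 * L n ^+ 2).
  move: (1 - q) q1' => c c0; have := gt_eqF c0; have := gt_eqF delta_gt0.
  have := gt_eqF Ln0; have := gt_eqF Lm0 => *; field.
  by do ?[apply/andP; split]; apply/negbT.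
apply: ler_wpM2l decay; apply: divr_ge0 K0 _.
by apply: mulr_ge0; exact: sqr_ge0.
Qed.

(** Summing the geometric factors costs one more power of [(1 - q)^-1]. *)
Lemma sum_weight_le m :
  \sum_(i < m.+1) weight i <= 64 / (1 - q) ^+ 5 * weight m.
Proof.
have q1' : 0 < 1 - q by rewrite subr_gt0.
have q0 : 0 <= q by exact: sqr_ge0.
apply: (@le_trans _ _
  (\sum_(i < m.+1) 64 / (1 - q) ^+ 4 * weight m * q ^+ (m - i))).
  by apply: ler_sum => i _; rewrite mulrAC weight_le// leq_ord.
have -> : 64 / (1 - q) ^+ 5 * weight m =
    64 / (1 - q) ^+ 4 * weight m * (1 - q)^-1.
  by move: (1 - q) q1' => c /lt0r_neq0 c0; field.
rewrite -mulr_sumr.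
apply: ler_wpM2l; last exact: geometric_sum_le.
apply: mulr_ge0 (ltW (weight_gt0 _)); apply: divr_ge0 => //.
by apply/exprn_ge0/ltW.
Qed.

End RadialMass.

(** * Positivity of the area of a disk *)

Section AreaDisk.
Variable R : realType.
Local Notation area := (@lebesgue_measure R \x @lebesgue_measure R)%E.

Lemma annulus_sub_disk (s rho : R) : annulus s rho `<=` disk rho.
Proof. by move=> x /andP[]. Qed.

Lemma area_disk_gt0 (rho : R) : 0 < rho -> 0 < fine (area (disk rho)).
Proof.
move=> rho0; have h : rho / 2 <= rho by lra.
apply: (@lt_le_trans _ _ (fine (area (annulus (rho / 2) rho)))).
  apply: lt_le_trans (area_annulus_ge (lexx (rho / 2)) h rho0).
  by rewrite divr_gt0// mulr_gt0//; lra.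
have le : (area (annulus (rho / 2) rho) <= area (disk rho))%E.
  apply: le_measure; rewrite ?inE.
  - exact: measurable_annulus.
  - exact: measurable_disk.
  - exact: annulus_sub_disk.
have fin := area_disk_lty rho.
apply: (fine_le _ _ le); rewrite ge0_fin_numE//.
exact: le_lt_trans le fin.
Qed.

End AreaDisk.

(** * The index function as a radial sum of modes, and its averages *)

Section IndexFunction.
Variables (R : realType) (k delta : R) (gamma : R[i]).
Hypotheses (k_gt0 : 0 < k) (delta_gt0 : 0 < delta) (gamma_neq0 : gamma != 0).
Local Notation q := ((k * delta / 2) ^+ 2).
Hypothesis q_lt1 : q < 1.

Local Notation area := (@lebesgue_measure R \x @lebesgue_measure R)%E.
Local Notation L := (fun n => besselJ_lead n (k * delta)).
Local Notation A := (radial_mass k delta).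
Local Notation normc := ComplexField.Normc.normc.

Lemma besselJ_sqr (n : int) (x : R) :
  besselJ n x ^+ 2 = besselJ_nat `|n|%N x ^+ 2.
Proof. by case: n => [p|p] //=; rewrite exprMn sqrr_sign mul1r. Qed.

Lemma sFourierE (n : int) :
  sFourier k delta gamma n = (2 * pi)%:C%C * gamma * (A `|n|%N)%:C%C.
Proof.
rewrite /sFourier /radial_mass; congr (_ * (_)%:C%C).
by apply: eq_Rintegral => x _; rewrite besselJ_sqr.
Qed.

(** The condition [|n| < N / 2] says that [|n|] is below the ceiling of [N / 2], which is
    [uphalf N]. As [Negz i] is [-(i + 1)], the negative orders are one fewer. *)
Definition index_seq (N : nat) : seq int :=
  [seq Posz i | i <- iota 0 (uphalf N)] ++
  [seq Negz i | i <- iota 0 (uphalf N).-1].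

Lemma index_seq_uniq N : uniq (index_seq N).
Proof.
rewrite cat_uniq !map_inj_uniq ?iota_uniq ?andbT//=; last 2 first.
- by move=> i j [].
- by move=> i j [].
by apply/hasPn => x /mapP[i _ ->]; apply/mapP => -[].
Qed.

Lemma index_seqE N :
  [set n : int | (`|n|%:~R : R) < N%:R / 2] = [set` index_seq N].
Proof.
have half (i : nat) : ((i%:R : R) < N%:R / 2) = (i < uphalf N)%N.
  rewrite ltr_pdivlMr// -natrM ltr_nat; lia.
apply/seteqP; split=> n /=; rewrite mem_cat.
- case: n => i; rewrite ?NegzE ?normrN /= -?pmulrn half => hi.
    by rewrite map_f// mem_iota.
  by apply/orP; right; rewrite -NegzE map_f// mem_iota; lia.
- case/orP => /mapP[i + ->]; rewrite mem_iota => /andP[_ hi].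
    by rewrite /= -pmulrn half.
  by rewrite NegzE normrN /= -pmulrn half; lia.
Qed.

Definition mode (i : nat) (t : R) : R := (besselJ_nat i (k * t) / A i) ^+ 2.

Definition radial_index (N : nat) (t : R) : R :=
  \sum_(i < uphalf N) mode i t + \sum_(i < (uphalf N).-1) mode i.+1 t.

Lemma mode_ge0 i t : 0 <= mode i t. Proof. exact: sqr_ge0. Qed.

(** The squared modulus of the factor common to all coefficients; its inverse multiplies both
    averages and cancels in their ratio. *)
Let kappa := normc ((2 * pi)%:C%C * gamma) ^+ 2.

Lemma kappa_gt0 : 0 < kappa.
Proof.
rewrite exprn_gt0// lt0r; apply/andP; split.
  apply/eqP => /ComplexField.Normc.eq0_normc/eqP; rewrite mulf_eq0.
  rewrite (negPf gamma_neq0) orbF => /eqP[] /eqP.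
  by rewrite mulf_eq0 pnatr_eq0/= gt_eqF// pi_gt0.
by case: (_ * gamma) => a b; exact: sqrtr_ge0.
Qed.

(** All terms share one complex factor and are otherwise nonnegative reals, so the modulus of the
    sum involves no cancellation. *)
Lemma normc_Iw_inv N x :
  normc (Iw_inv k delta gamma N x) = kappa^-1 * radial_index N (enorm x).
Proof.
have normX2 (z : R[i]) : normc (z ^+ 2) = normc z ^+ 2.
  by rewrite expr2 ComplexField.Normc.normcM.
have -> : Iw_inv k delta gamma N x =
    ((2 * pi)%:C%C * gamma) ^- 2 * (radial_index N (enorm x))%:C%C.
  rewrite /Iw_inv index_seqE -fsbig_seq ?index_seq_uniq//.
  have termE n : (besselJ n (k * enorm x) ^+ 2)%:C%C / sFourier k delta gamma n ^+ 2
      = ((2 * pi)%:C%C * gamma) ^- 2 * (mode `|n|%N (enorm x))%:C%C.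
    rewrite sFourierE besselJ_sqr exprMn invfM mulrCA; congr (_ * _).
    by rewrite -rmorphXn -fmorphV -rmorphM /mode exprMn exprVn.
  under eq_bigr do rewrite termE.
  rewrite -mulr_sumr; congr (_ * _).
  rewrite -rmorph_sum/=; congr (_%:C)%C.
  have iotaE j : iota 0 j = index_iota 0 j by rewrite /index_iota subn0.
  by rewrite /index_seq big_cat/= !big_map !iotaE !big_mkord.
rewrite ComplexField.Normc.normcM ComplexField.Normc.normcV normX2; congr (_ * _).
rewrite /= expr0n/= addr0 sqrtr_sqr ger0_norm//.
by rewrite addr_ge0// sumr_ge0// => i _; exact: mode_ge0.
Qed.

(** The negative orders repeat the modes of positive order; counting mode [0] twice as well gives
    the factor [2]. *)
Lemma radial_index_le m N t : uphalf N = m.+1 ->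
  radial_index N t <= 2 * \sum_(i < m.+1) mode i t.
Proof.
move=> Nm; rewrite /radial_index Nm /=.
have -> : 2 * \sum_(i < m.+1) mode i t =
   \sum_(i < m.+1) mode i t + \sum_(i < m.+1) mode i t by ring.
rewrite lerD2l [leRHS]big_ord_recl /= lerDr; exact: mode_ge0.
Qed.

Lemma mode_le_radial_index m N t : uphalf N = m.+1 ->
  mode m t <= radial_index N t.
Proof.
move=> Nm; rewrite /radial_index Nm big_ord_recr/= -addrA addrCA lerDl.
by rewrite addr_ge0// sumr_ge0// => i _; exact: mode_ge0.
Qed.

Lemma measurable_radial_index N (rho : R) :
  measurable_fun (disk rho) (fun x : plane R => radial_index N (enorm x)).
Proof.
have mm i : measurable_fun (disk rho) (fun x : plane R => mode i (enorm x)).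
  apply: measurable_funX; apply: measurable_funM => //.
  apply: measurable_besselJ; first exact: measurable_disk.
    apply: measurable_funM => //.
    by apply: measurable_funTS; exact: measurable_enorm.
  by move=> x _; rewrite mulr_ge0 ?enorm_ge0 ?ltW.
apply: measurable_funD; apply: measurable_sum => i; exact: mm.
Qed.

Lemma mode_bounded i (t rho : R) : 0 <= t -> t <= rho ->
  mode i t <= (((k * rho / 2) ^+ i * expR ((k * rho / 2) ^+ 2)) / A i) ^+ 2.
Proof.
move=> t0 trho; have A0 : 0 < A i by exact: radial_mass_gt0.
have x0 : 0 <= k * t by rewrite mulr_ge0// ltW.
have xr : k * t <= k * rho by rewrite ler_pM2l.
rewrite /mode -real_normK ?num_real// lerXn2r ?nnegrE//.
  by rewrite divr_ge0 ?mulr_ge0 ?exprn_ge0 ?expR_ge0 ?(ltW A0)//; lra.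
rewrite normrM normfV (gtr0_norm A0) ler_wpM2r ?invr_ge0 ?(ltW A0)//.
apply: le_trans (besselJ_bounded i x0) _; apply: ler_pM.
- by rewrite exprn_ge0//; lra.
- exact: expR_ge0.
- by rewrite lerXn2r ?nnegrE//; lra.
- by rewrite ler_expR lerXn2r ?nnegrE//; lra.
Qed.

Lemma mode_le_weight i t : 0 <= t -> t <= delta -> mode i t <= weight k delta i.
Proof.
move=> t0 t_le; have A0 : 0 < A i by exact: radial_mass_gt0.
have [/andP[_ J_le] J0] := besselJ_disk k_gt0 delta_gt0 q_lt1 i t0 t_le.
have L0 : 0 < L i by apply: besselJ_lead_gt0; exact: mulr_gt0.
have [JA LA] := (divr_ge0 J0 (ltW A0), divr_ge0 (ltW L0) (ltW A0)).
rewrite /mode /weight lerXn2r//.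
rewrite ler_wpM2r ?invr_ge0 ?(ltW A0)// (le_trans J_le)// besselJ_lead_le//.
  by rewrite mulr_ge0// ltW.
by rewrite ler_pM2l.
Qed.

Lemma avgL1_disk_le N m : uphalf N = m.+1 ->
  avgL1 (disk delta) (Iw_inv k delta gamma N) <=
    kappa^-1 * (128 / (1 - q) ^+ 5 * weight k delta m).
Proof.
move=> Nm; rewrite /avgL1.
under eq_Rintegral do rewrite normc_Iw_inv.
have kV : 0 <= kappa^-1 by rewrite invr_ge0 ltW// kappa_gt0.
have aV := area_disk_gt0 delta_gt0.
rewrite ler_pdivrMl// mulrC.
(* Only the upper half is wanted, so the lower one is taken trivial, with [c = 0] on the empty
   set. *)
have /andP[_ //] : 0 * fine (area set0) <=
  \int[area]_(x in disk delta) (kappa^-1 * radial_index N (enorm x)) <=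
  kappa^-1 * (128 / (1 - q) ^+ 5 * weight k delta m) * fine (area (disk delta)).
apply: (@Rintegral_bounds _ _ _ area).
- exact: measurable_disk.
- exact: measurable0.
- exact: sub0set.
- exact: area_disk_lty.
- by apply: measurable_funM => //; exact: measurable_radial_index.
- move=> x _; apply: mulr_ge0 => //.
  exact: le_trans (mode_ge0 _ _) (mode_le_radial_index _ Nm).
- move=> x /ltW xd; apply: ler_wpM2l => //.
  apply: le_trans (radial_index_le _ Nm) _.
  have -> : 128 / (1 - q) ^+ 5 * weight k delta m =
    2 * (64 / (1 - q) ^+ 5 * weight k delta m) by rewrite !mulrA -natrM.
  rewrite ler_wpM2l//; apply: le_trans (sum_weight_le k_gt0 delta_gt0 q_lt1 m).
  by apply: ler_sum => i _; rewrite mode_le_weight ?enorm_ge0.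
- by [].
- by [].
Qed.

(** The radius is arbitrary because the bound is applied twice: at [r] for the numerator, and at
    [delta] for the positivity of the denominator. The smallness condition makes the top mode at
    least half of its leading term. *)
Lemma avgL1_disk_ge N m (rho : R) : uphalf N = m.+1 -> (0 < m)%N -> 0 < rho ->
  (k * rho / 2) ^+ 2 <= m.+1%:R / 2 ->
  kappa^-1 * (rho ^+ 2 / (128 * m%:R * fine (area (disk rho))) *
    ((rho / delta) ^+ (2 * m) * weight k delta m))
  <= avgL1 (disk rho) (Iw_inv k delta gamma N).
Proof.
move=> Nm m0 rho0 rho_small; rewrite /avgL1.
under eq_Rintegral do rewrite normc_Iw_inv.
have kV : 0 <= kappa^-1 by rewrite invr_ge0 ltW// kappa_gt0.
have aV := area_disk_gt0 rho0.
rewrite ler_pdivlMl//.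
have m0' : 0 < m%:R :> R by rewrite ltr0n.
have m1 : 1 <= m%:R :> R by rewrite ler1n.
(* The relative width [1 / (4 * m)] is chosen so that [t ^+ (2 * m)] is at least one half. *)
set t : R := 1 - (2 * (2 * m))%:R^-1.
have tE : t = 1 - (4 * m%:R)^-1 by rewrite /t mulnA natrM.
have m4 : (4 * m%:R)^-1 <= 2^-1 :> R by rewrite lef_pV2 ?posrE//; lra.
have m40 : 0 < (4 * m%:R)^-1 :> R by rewrite invr_gt0//; lra.
have t_half : 2^-1 <= t ^+ (2 * m) by apply: half_le_expr; rewrite muln_gt0.
have t0 : 0 <= t by lra.
have A0 : 0 < A m by exact: radial_mass_gt0.
have L0 : 0 < L m by apply: besselJ_lead_gt0; exact: mulr_gt0.
(* The [8] collects [4] from the squared half of the leading term and [2] from [t ^+ (2 * m)]. With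
   the [16] of the annulus area it makes [128]. *)
set c := kappa^-1 * ((rho / delta) ^+ (2 * m) * weight k delta m / 8).
have c0 : 0 <= c.
  rewrite mulr_ge0// divr_ge0// mulr_ge0 ?sqr_ge0// exprn_ge0// divr_ge0//;
  exact: ltW.
have rd0 : 0 <= rho / delta by rewrite divr_ge0// ltW.
have area_E : rho ^+ 2 / (16 * m%:R) <= fine (area (annulus (t * rho) rho)).
  apply: le_trans (area_annulus_ge _ _ rho0).
  - rewrite tE le_eqVlt; apply/predU1P; left; field; exact: lt0r_neq0.
  - by rewrite mulrC ler_pM2r//; lra.
  - by rewrite ler_piMl ?(ltW rho0)//; lra.
apply: (@le_trans _ _ (c * fine (area (annulus (t * rho) rho)))).
  apply: le_trans (ler_wpM2l c0 area_E).
  rewrite /c le_eqVlt; apply/predU1P; left.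
  move: (kappa^-1) ((rho / delta) ^+ (2 * m) * weight k delta m) => K W.
  move: (m%:R : R) m0' (fine (area (disk rho))) aV => b /lt0r_neq0 b0 a.
  by move=> /lt0r_neq0 a0; field; apply/andP.
(* A finite upper bound on the whole disk, which provides integrability. *)
pose M := kappa^-1 * (2 * \sum_(i < m.+1)
  (((k * rho / 2) ^+ i * expR ((k * rho / 2) ^+ 2)) / A i) ^+ 2).
have /andP[//] : c * fine (area (annulus (t * rho) rho)) <=
  \int[area]_(x in disk rho) (kappa^-1 * radial_index N (enorm x)) <=
  M * fine (area (disk rho)).
apply: (@Rintegral_bounds _ _ _ area).
- exact: measurable_disk.
- exact: measurable_annulus.
- exact: annulus_sub_disk.
- exact: area_disk_lty.
- by apply: measurable_funM => //; exact: measurable_radial_index.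
- move=> x _; apply: mulr_ge0 => //.
  exact: le_trans (mode_ge0 _ _) (mode_le_radial_index _ Nm).
- move=> x /ltW xd; apply: ler_wpM2l => //.
  apply: le_trans (radial_index_le _ Nm) _.
  rewrite ler_wpM2l//.
  by apply: ler_sum => i _; rewrite mode_bounded ?enorm_ge0.
- by [].
- move=> x /andP[tx /ltW xr]; apply: ler_wpM2l => //.
  apply: le_trans (mode_le_radial_index _ Nm).
  set s := enorm x in tx xr *; have s0 : 0 <= s by exact: enorm_ge0.
  have ks0 : 0 <= k * s by rewrite mulr_ge0// ltW.
  have ks : (k * s / 2) ^+ 2 <= m.+1%:R / 2.
    apply: le_trans rho_small; have : k * s <= k * rho by rewrite ler_pM2l.
    by move=> h; rewrite lerXn2r ?nnegrE//; lra.
  have m10 : 0 < m.+1%:R :> R by rewrite ltr0n.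
  have V0 : 0 <= t ^+ m * ((rho / delta) ^+ m * L m).
    exact: mulr_ge0 (exprn_ge0 _ t0) (mulr_ge0 (exprn_ge0 _ rd0) (ltW L0)).
  have J_ge : 2^-1 * (t ^+ m * ((rho / delta) ^+ m * L m)) <= besselJ_nat m (k * s).
    have ks' : (k * s / 2) ^+ 2 <= m.+1%:R by lra.
    apply: le_trans (besselJ_ge_lead ks0 ks').
    apply: ler_pM => //.
    - have : (k * s / 2) ^+ 2 / m.+1%:R <= 2^-1 by rewrite ler_pdivrMr//; lra.
      move: (_ / m.+1%:R) => u u_le; lra.
    - rewrite -!besselJ_leadM; apply: besselJ_lead_le.
        exact: mulr_ge0 t0 (mulr_ge0 rd0 (ltW (mulr_gt0 k_gt0 delta_gt0))).
      have -> : t * (rho / delta * (k * delta)) = k * (t * rho).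
        by field; exact: lt0r_neq0.
      by rewrite ler_pM2l.
  have J0 : 0 <= 2^-1 * (t ^+ m * ((rho / delta) ^+ m * L m)).
    exact: mulr_ge0.
  apply: (@le_trans _ _
    ((2^-1 * (t ^+ m * ((rho / delta) ^+ m * L m)) / A m) ^+ 2)); last first.
    rewrite lerXn2r ?nnegrE ?(divr_ge0 _ (ltW A0)) ?(le_trans J0 J_ge)//.
    by rewrite ler_wpM2r ?invr_ge0 ?(ltW A0).
  have -> : (2^-1 * (t ^+ m * ((rho / delta) ^+ m * L m)) / A m) ^+ 2 =
    (rho / delta) ^+ (2 * m) * weight k delta m / 4 * t ^+ (2 * m).
    rewrite /weight mulnC !exprM; move: (A m) A0 => a a0.
    by move: (t ^+ m) ((rho / delta) ^+ m) => *; field; exact: lt0r_neq0.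
  have -> : (rho / delta) ^+ (2 * m) * weight k delta m / 8 =
    (rho / delta) ^+ (2 * m) * weight k delta m / 4 * 2^-1 by field.
  by rewrite ler_wpM2l// divr_ge0// mulr_ge0 ?sqr_ge0 ?exprn_ge0.
Qed.

End IndexFunction.

(** * Exponential growth against the factor [1 / N] *)

Section Growth.
Variable R : realType.

(** Bernoulli's inequality, with [N <= 3 * (N %/ 2)] for [N >= 2]. *)
Lemma linear_le_expr_half (u : R) N : 1 < u -> (1 < N)%N ->
  (u - 1) / 3 * N%:R <= u ^+ (N %/ 2).
Proof.
move=> u1 N1; have -> : u ^+ (N %/ 2) = (1 + (u - 1)) ^+ (N %/ 2) by rewrite subrKC.
apply: le_trans (bernoulli _ _); last by lra.
rewrite -[_ *+ (N %/ 2)]mulr_natr.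
have : N%:R <= 3 * (N %/ 2)%:R :> R by rewrite -natrM ler_nat; lia.
move: (N%:R : R) ((N %/ 2)%:R : R) => x y xy.
have : (u - 1) * x <= (u - 1) * (3 * y) by rewrite ler_pM2l// subr_gt0.
lra.
Qed.

(** One of the two factors [u ^+ (N %/ 2)] absorbs the division by [N]. *)
Lemma expr_half_le (u : R) N : 1 < u -> (1 < N)%N ->
  (u - 1) / 3 * u ^+ (N %/ 2) <= u ^+ (2 * (N %/ 2)) / N%:R.
Proof.
move=> u1 N1; rewrite ler_pdivlMr ?ltr0n; last by lia.
rewrite mul2n -addnn exprD mulrAC ler_wpM2r ?linear_le_expr_half//.
by rewrite exprn_ge0//; lra.
Qed.

Lemma expr_half_div_cvgy (u C : R) : 1 < u -> 0 < C ->
  (fun N : nat => C * (u ^+ (2 * (N %/ 2)) / N%:R)) @ \oo --> +oo.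
Proof.
move=> u1 C0; apply/cvgryPge => B.
have c0 : 0 < (u - 1) / 3 by rewrite divr_gt0// subr_gt0.
set c := (u - 1) / 3 in c0.
near=> N.
have N1 : (1 < N)%N by near: N; exact: nbhs_infty_gt.
rewrite -ler_pdivrMl//; apply: le_trans (expr_half_le u1 N1).
rewrite -ler_pdivrMl//; apply: le_trans (linear_le_expr_half u1 N1).
rewrite -ler_pdivrMl//.
by near: N; exact: nbhs_infty_ger.
Unshelve. all: by end_near. Qed.

(** Since [N <= 2 * (N %/ 2).+1], the remaining factor dominates [Num.sqrt u ^+ N] up to one power
    of [u]. *)
Lemma expr_sqrt_le (u : R) N : 1 < u -> (1 < N)%N ->
  (u - 1) / 3 / u * Num.sqrt u ^+ N <= u ^+ (2 * (N %/ 2)) / N%:R.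
Proof.
move=> u1 N1; apply: le_trans (expr_half_le u1 N1).
have u0 : 0 < u by lra.
rewrite -mulrA ler_wpM2l//; first by rewrite divr_ge0// subr_ge0 ltW.
rewrite ler_pdivrMl// -exprS.
have -> : u ^+ (N %/ 2).+1 = Num.sqrt u ^+ (2 * (N %/ 2).+1).
  by rewrite exprM sqr_sqrtr// ltW.
rewrite ler_weXn2l//; last by lia.
by rewrite -sqrtr1 ler_sqrt ltW.
Qed.

End Growth.

(** * Comparison of the two averages and conclusion *)

Lemma uphalf_bounds N : (2 < N)%N -> exists m,
  [/\ uphalf N = m.+1, 0 < m, m <= N, N <= 2 * m.+1 & N %/ 2 <= m.+1]%N.
(* The witness is the top mode, one less than the ceiling of [N / 2]. For even [N] it is one below
   [N %/ 2], hence the last bound. *)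
Proof. by move=> N2; exists (uphalf N).-1; split; lia. Qed.

Lemma avg_ratio_ge (R : realType) (k delta r : R) (gamma : R[i]) :
  0 < k -> 0 < delta -> (k * delta / 2) ^+ 2 < 1 -> delta < r -> gamma != 0 ->
  exists2 C : R, 0 < C & \forall N \near \oo,
    C * ((r / delta) ^+ (2 * (N %/ 2)) / N%:R) <= avg_ratio k delta gamma r N.
Proof.
move=> k0 d0 q1 dr g0; have r0 : 0 < r by exact: lt_trans dr.
have u1 : 1 < r / delta by rewrite ltr_pdivlMr ?mul1r.
set area := fine ((@lebesgue_measure R \x @lebesgue_measure R)%E (disk r)).
have a0 : 0 < area by exact: area_disk_gt0.
pose U := 128 / (1 - (k * delta / 2) ^+ 2) ^+ 5.
have U0 : 0 < U by apply: divr_gt0 => //; apply: exprn_gt0; rewrite subr_gt0.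
have aU0 : 0 < 128 * area * U by apply: mulr_gt0 => //; exact: mulr_gt0.
(* The factor [r ^+ 2] of the lower average, divided by the loss [(r / delta) ^+ 2] from
   [N %/ 2 <= m.+1], leaves [delta ^+ 2]. *)
exists (delta ^+ 2 / (128 * area * U)).
  exact: divr_gt0 (exprn_gt0 _ d0) aU0.
near=> N.
have N2 : (2 < N)%N by near: N; exact: nbhs_infty_gt.
have [m [Nm m0 mN Nm2 N2m]] := uphalf_bounds N2.
have small (rho : R) : 0 < rho -> rho <= r -> (k * rho / 2) ^+ 2 <= m.+1%:R / 2.
  move=> rho0 rho_le; apply: (@le_trans _ _ ((k * r / 2) ^+ 2)).
    have : k * rho <= k * r by rewrite ler_pM2l.
    have : 0 < k * rho by exact: mulr_gt0.
    by move=> h1 h2; rewrite lerXn2r ?nnegrE//; lra.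
  have : (k * r / 2) ^+ 2 * 4 <= N%:R by near: N; exact: nbhs_infty_ger.
  have : N%:R <= 2 * m.+1%:R :> R by rewrite -natrM ler_nat.
  by lra.
have up := avgL1_disk_le k0 d0 g0 q1 Nm.
have lo := avgL1_disk_ge k0 d0 g0 q1 Nm m0 r0 (small _ r0 (lexx _)).
(* At radius [delta] the lower bound shows that the denominator of the ratio is positive. *)
have := avgL1_disk_ge k0 d0 g0 q1 Nm m0 d0 (small _ d0 (ltW dr)).
have w0 := weight_gt0 k0 d0 q1 m.
have m0' : 0 < m%:R :> R by rewrite ltr0n.
have kap0 := kappa_gt0 g0.
rewrite /avg_ratio.
move: (avgL1 (disk r) _) (avgL1 (disk delta) _) lo up => Ir Id.
rewrite -/area -/U; set kap := _ ^+ 2 in kap0 *.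
move: kap kap0 (weight k delta m) w0 => K K0 w w0 lo up.
have K0' : 0 < K^-1 by rewrite invr_gt0.
rewrite divff ?gt_eqF// expr1n mul1r => lod.
have Id0 : 0 < Id.
  apply: lt_le_trans lod; apply: mulr_gt0 => //; apply: mulr_gt0 => //.
  apply: divr_gt0; first exact: exprn_gt0.
  by apply: mulr_gt0; [exact: mulr_gt0|exact: area_disk_gt0].
rewrite ler_pdivlMr//.
have uN : (r / delta) ^+ (2 * (N %/ 2)) / N%:R <=
    (r / delta) ^+ (2 * m) * (r / delta) ^+ 2 / m%:R.
  apply: ler_pM.
  - by rewrite exprn_ge0//; lra.
  - by [].
  - by rewrite -exprD ler_weXn2l ?ltW// -mulnSr leq_mul2l.
  - by rewrite lef_pV2 ?posrE ?ltr0n ?ler_nat// (leq_trans m0).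
apply: le_trans lo.
apply: (@le_trans _ _ (delta ^+ 2 / (128 * area * U) *
  ((r / delta) ^+ (2 * m) * (r / delta) ^+ 2 / m%:R) * (K^-1 * (U * w)))).
  apply: ler_pM up.
  - apply: mulr_ge0; first exact: divr_ge0 (sqr_ge0 _) (ltW aU0).
    by rewrite divr_ge0// exprn_ge0//; lra.
  - exact: ltW.
  - by apply: ler_wpM2l uN; exact: divr_ge0 (sqr_ge0 _) (ltW aU0).
rewrite le_eqVlt; apply/predU1P; left.
move: ((r / delta) ^+ (2 * m)) (m%:R : R) m0' => V b /lt0r_neq0 b0.
clear up aU0; move: (area) a0 U U0 => a /lt0r_neq0 a0 c /lt0r_neq0 c0.
move/lt0r_neq0 in d0; move/lt0r_neq0 in K0.
by field; do ?[apply/andP; split].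
Unshelve. all: by end_near. Qed.

Theorem theorem3p5 (R : realType) (k alpha delta r : R) (gamma : R[i])
    (k_gt0 : 0 < k)
    (alpha_gt0 : 0 < alpha) (alpha_le : alpha <= pi / 2)
    (delta_gt0 : 0 < delta) (kdelta_lt : k * delta < pi / 2)
    (r_gt : delta < r) (gamma_neq0 : gamma != 0) :
  exists C : R,
    [/\ 0 < C,
        \forall N \near \oo,
          C * ((r / delta) ^+ (2 * (N %/ 2)) / N%:R)
            <= avg_ratio k delta gamma r N,
        (fun N : nat => C * ((r / delta) ^+ (2 * (N %/ 2)) / N%:R))
          @ \oo --> +oo
      & exists c a : R,
          [/\ 0 < c, 1 < a &
              \forall N \near \oo, c * a ^+ N <= avg_ratio k delta gamma r N]].
Proof.
have q1 : (k * delta / 2) ^+ 2 < 1.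
  have kd0 : 0 < k * delta by exact: mulr_gt0.
  (* This supplies the bound of [pi / 2] by [2]. *)
  have [/andP[_ pi2] _] := @pihalf_02_cos_pihalf R.
  by rewrite expr_lt1//; lra.
have u1 : 1 < r / delta by rewrite ltr_pdivlMr ?mul1r.
have [C C0 ratio_ge] := avg_ratio_ge k_gt0 delta_gt0 q1 r_gt gamma_neq0.
exists C; split => //; first exact: expr_half_div_cvgy.
have u0 : 0 < r / delta by exact: lt_trans u1.
(* Half of the exponent is spent on the factor [1 / N], so the base left is the square root of
   [r / delta]. *)
exists (C * ((r / delta - 1) / 3 / (r / delta))), (Num.sqrt (r / delta)); split.
- by apply: mulr_gt0 => //; apply: divr_gt0 => //; apply: divr_gt0; rewrite ?subr_gt0.
- by rewrite -[ltLHS]sqrtr1 ltr_sqrt.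
near=> N.
have N1 : (1 < N)%N by near: N; exact: nbhs_infty_gt.
apply: (@le_trans _ _ (C * ((r / delta) ^+ (2 * (N %/ 2)) / N%:R))).
  by rewrite -mulrA ler_pM2l// expr_sqrt_le.
by near: N.
Unshelve. all: by end_near. Qed.
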